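(* If $G$ is an existentially closed group, then $G$ does not have property (T).
   Context: A group $G$ is existentially closed (e.c.) if, for any finite system $p(\vec x)$ of equations and inequations (expressions $w=e$ or $w\neq e$ with $w$ a word in the variables $\vec x$, their inverses, and elements of $G$) with coefficients from $G$, if there is a solution to $p(\vec x)$ in some group extension of $G$ (a group containing $G$ as a subgroup), then there is a solution to $p(\vec x)$ in $G$. Property (T) is Kazhdan's property (T) for discrete groups. *)

(* Defs.v *)
From HB Require Import structures.
From mathcomp Require Import all_boot all_order all_algebra.
From mathcomp Require Import sesquilinear complex.
From mathcomp Require Import all_classical all_reals all_analysis.

Set Implicit Arguments.
Unset Strict Implicit.
Unset Printing Implicit Defensive.

Import Order.TTheory GRing.Theory Num.Theory.
Import numFieldNormedType.Exports.

Local Open Scope ring_scope.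
Local Open Scope complex_scope.

Section ExistentiallyClosed.
Local Open Scope group_scope.

Inductive letter (G : Type) (n : nat) : Type :=
  | Coef of G
  | Var of 'I_n
  | VarInv of 'I_n.

Definition word (G : Type) (n : nat) : Type := seq (letter G n).

Inductive condition (G : Type) (n : nat) : Type :=
  | Equation of word G n
  | Inequation of word G n.

Definition system (G : Type) (n : nat) : Type := seq (condition G n).

(* The coefficients, taken from G, are read in K through f : G -> K.          *)
Definition eval_letter (G : Type) (K : groupType) (n : nat)
    (f : G -> K) (x : 'I_n -> K) (l : letter G n) : K :=
  match l with
  | Coef g => f g
  | Var i => x i
  | VarInv i => (x i)^-1
  end.

Definition eval_word (G : Type) (K : groupType) (n : nat)
    (f : G -> K) (x : 'I_n -> K) (w : word G n) : K :=
  \prod_(l <- w) eval_letter f x l.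

Definition holds (G : Type) (K : groupType) (n : nat)
    (f : G -> K) (x : 'I_n -> K) (c : condition G n) : bool :=
  match c with
  | Equation w => eval_word f x w == 1
  | Inequation w => eval_word f x w != 1
  end.

Definition is_solution (G : Type) (K : groupType) (n : nat)
    (f : G -> K) (x : 'I_n -> K) (p : system G n) : bool :=
  all (holds f x) p.

(* A group extension of G is a group K with an injective morphism G -> K.     *)
Definition existentially_closed (G : groupType) : Prop :=
  forall (n : nat) (p : system G n),
    (exists (K : groupType) (f : {multiplicative G -> K}),
       injective f /\ exists x : 'I_n -> K, is_solution f x p) ->
    exists x : 'I_n -> G, is_solution idfun x p.

End ExistentiallyClosed.

(* A complex Hilbert space. The inner product is linear in its first argument *)
(* and conjugate-linear in its second one. The norm takes values in R[i].     *)
Record hilbert_space (R : realType) := HilbertSpace {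
  hilbert_sort :> completeNormedModType R[i] ;
  inner : {dot hilbert_sort for (@Num.conj R[i])} ;
  innerE : forall x : hilbert_sort, inner x x = `|x| ^+ 2
}.

(* Surjectivity of each operator follows from the two action laws.            *)
Record unitary_rep (R : realType) (G : groupType) (H : hilbert_space R) :=
  UnitaryRep {
    rep :> G -> {linear H -> H} ;
    rep1 : forall x : H, rep 1%g x = x ;
    repM : forall (g h : G) (x : H), rep (g * h)%g x = rep g (rep h x) ;
    rep_inner : forall (g : G) (x y : H),
      inner H (rep g x) (rep g y) = inner H x y
  }.

Definition is_invariant (R : realType) (G : groupType) (H : hilbert_space R)
    (pi : unitary_rep G H) (x : H) : Prop :=
  forall g : G, pi g x = x.

(* (Q, eps)-invariance; x is required to be nonzero so that the notion is the *)
(* intended one for Q = [::] as well.                                         *)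
Definition almost_invariant (R : realType) (G : groupType)
    (H : hilbert_space R) (pi : unitary_rep G H) (Q : seq G) (eps : R)
    (x : H) : Prop :=
  x != 0 /\ (forall g : G, g \in Q -> `|pi g x - x| < eps%:C * `|x|).

(* Kazhdan's property (T) for G with the discrete topology: compact subsets   *)
(* are the finite ones, and strong continuity of representations is vacuous.  *)
Definition property_T (R : realType) (G : groupType) : Prop :=
  exists (Q : seq G) (eps : R), 0 < eps /\
    forall (H : hilbert_space R) (pi : unitary_rep G H),
      (exists x : H, almost_invariant pi Q eps x) ->
      exists x : H, x != 0 /\ is_invariant pi x.

(* Main.v *)
(* G acts by conjugation on X = G \ {1}. If G is existentially closed, every    *)
(* finite subset of G fixes a point of X: in the wreath product of G with Z/2, *)
(* the swap is nontrivial and commutes with the diagonal copy of G. Moreover   *)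
(* every orbit in X is infinite: conjugation by the swap sends (z, 1) to       *)
(* (1, z), outside of the left copy of G, so no finite list of elements of G   *)
(* can exhaust the conjugates of z. Hence in the permutation representation on *)
(* l2(X) every finite subset of G fixes some delta function, whereas an        *)
(* invariant function is constant on infinite orbits and therefore zero.       *)
From HB Require Import structures.
Require Import Defs.
From mathcomp Require Import all_boot all_order all_algebra.
From mathcomp Require Import ring lra.
From mathcomp Require Import sesquilinear complex.
From mathcomp Require Import all_classical all_reals all_analysis.

Set Implicit Arguments.
Unset Strict Implicit.
Unset Printing Implicit Defensive.

Import Order.TTheory GRing.Theory Num.Theory.
Import numFieldNormedType.Exports.

Local Open Scope classical_set_scope.
Local Open Scope ring_scope.
Local Open Scope complex_scope.

(* Num.Theory shadows these names by the projections of numClosedFieldType.    *)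
Local Notation Re := complex.Re.
Local Notation Im := complex.Im.

(** * The wreath product *)

(** Two embeddings of G into the wreath product are used: the swap centralizes the diagonal copy,
    and it moves the left copy so that the two meet only in 1. Existential closedness transfers one
    finite system from each. [ec_commuting] yields a nontrivial element centralizing a given finite
    set, and [ec_conjugates_infinite] shows that a finite list never contains the whole class of a
    nontrivial element.

    On the analytic side, [l2_hilbert] builds l2(X) from suprema of finite partial sums. In
    [permutation_rep], a point fixed by Q gives a delta function exactly invariant under Q, hence
    almost invariant for every eps > 0. By [invariant_eq0], a globally invariant vector vanishes,
    being square-summable and constant on infinite orbits. [not_property_T] combines the two for any
    action with these features, and the theorem applies it to conjugation. *)

Section Wreath.
Local Open Scope group_scope.
Variable G : groupType.

(* The boolean is the Z/2 component. *)
Definition wreath2 : Type := (G * G * bool)%type.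

HB.instance Definition _ := Choice.on wreath2.

Definition wreath2_one : wreath2 := (1, 1, false).

Definition wreath2_mul (u v : wreath2) : wreath2 :=
  let: (a, b, s) := u in let: (c, d, t) := v in
  if s then (a * d, b * c, ~~ t) else (a * c, b * d, t).

Definition wreath2_inv (u : wreath2) : wreath2 :=
  let: (a, b, s) := u in
  if s then (b^-1, a^-1, true) else (a^-1, b^-1, false).

Fact wreath2_mulA : associative wreath2_mul.
Proof. by move=> [[a b] []] [[c d] []] [[e f] []] /=; rewrite !mulgA. Qed.

Fact wreath2_mul1 : left_id wreath2_one wreath2_mul.
Proof. by move=> [[a b] s] /=; rewrite !mul1g. Qed.

Fact wreath2_mulr1 : right_id wreath2_one wreath2_mul.
Proof. by move=> [[a b] []] /=; rewrite !mulg1. Qed.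

Fact wreath2_mulV : left_inverse wreath2_one wreath2_inv wreath2_mul.
Proof. by move=> [[a b] []] /=; rewrite !mulVg. Qed.

Fact wreath2_mulrV : right_inverse wreath2_one wreath2_inv wreath2_mul.
Proof. by move=> [[a b] []] /=; rewrite !mulgV. Qed.

HB.instance Definition _ := isGroup.Build wreath2
  wreath2_mulA wreath2_mul1 wreath2_mulr1 wreath2_mulV wreath2_mulrV.

Definition wreath2_diag (g : G) : wreath2 := (g, g, false).
Definition wreath2_left (g : G) : wreath2 := (g, 1, false).

Fact wreath2_diagM : {morph wreath2_diag : g h / g * h}.
Proof. by []. Qed.

Fact wreath2_leftM : {morph wreath2_left : g h / g * h}.
Proof. by move=> g h; congr (_, _, _); rewrite mulg1. Qed.

HB.instance Definition _ :=
  isMultiplicative.Build G wreath2 wreath2_diag wreath2_diagM.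
HB.instance Definition _ :=
  isMultiplicative.Build G wreath2 wreath2_left wreath2_leftM.

Hypothesis ecG : existentially_closed G.

(** The system asks for a nontrivial unknown whose commutator with each entry of Q is trivial. The
    swap solves it over the diagonal copy of G. *)
Lemma ec_commuting (Q : seq G) :
  exists2 z : G, z != 1 & forall q, q \in Q -> q * z * q^-1 = z.
Proof.
pose c q : condition G 1 :=
  Equation [:: Coef 1 q; Var G ord0; Coef 1 q^-1; VarInv G ord0].
case: (ecG (p := Inequation [:: Var G ord0] :: map c Q)) => [|x].
  exists wreath2, wreath2_diag; split; first by move=> g h [].
  exists (fun=> (1, 1, true)); rewrite /is_solution -cat1s all_cat all_seq1.
  rewrite all_map /= {1}/eval_word big_seq1; apply/andP; split; first exact/eqP.
  apply/allP => q _ /=.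
  (* Both G-coordinates of the evaluated commutator have this form. *)
  have e : q * (1 * (q^-1 * (1^-1 * 1))) = 1 by rewrite invg1 mul1g !mulg1 mulgV.
  by rewrite /eval_word !big_cons big_nil /=; apply/eqP; congr (_, _, _); exact: e.
rewrite /is_solution -cat1s all_cat all_seq1 all_map /= {1}/eval_word big_seq1.
move=> /andP[x1 /allP xQ]; exists (x ord0) => // q /xQ.
rewrite /= /eval_word !big_cons big_nil /= => /eqP h.
by apply: (mulIg (x ord0)^-1); rewrite mulgV -h !mulgA mulg1.
Qed.

Lemma ec_conjugates_infinite (z : G) (s : seq G) :
  z != 1 -> exists y : G, y * z * y^-1 \notin s.
Proof.
move=> z1.
pose c a : condition G 1 :=
  Inequation [:: Var G ord0; Coef 1 z; VarInv G ord0; Coef 1 a^-1].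
case: (ecG (p := map c s)) => [|x].
  exists wreath2, wreath2_left; split; first by move=> g h [].
  exists (fun=> (1, 1, true)).
  rewrite /is_solution all_map; apply/allP => a _ /=.
  (* With the swap as unknown the word is (a^-1, z) up to trivial factors; its second coordinate is
     not 1. *)
  rewrite /eval_word !big_cons big_nil /= /mul /=; apply: contraNneq z1 => -[].
  by rewrite !invg1 !mulg1 !mul1g => _ ->.
rewrite /is_solution all_map => /allP xs; exists (x ord0); apply/negP => /xs.
rewrite /= /eval_word !big_cons big_nil /= => /eqP; apply.
by rewrite mulg1 !mulgA mulgV.
Qed.

End Wreath.

(** * Unordered sums of real functions *)

Section UnorderedSums.
Variables (R : realType) (X : choiceType).
Implicit Types (a b : X -> R) (M c : R) (s : seq X).

Definition partial_sums a : set R :=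
  [set \sum_(x <- s) a x | s in [set s | uniq s]].

Definition sum_bounded a := has_ubound (partial_sums a).

(** Duplicate-free lists stand for finite subsets, so this is the unordered sum when [a] is
    nonnegative and [sum_bounded]. *)
Definition sup_sum a : R := sup (partial_sums a).

Lemma partial_sums_nonempty a : partial_sums a !=set0.
Proof. by exists 0, [::] => //; rewrite big_nil. Qed.

Lemma sup_sum_ub a s : sum_bounded a -> uniq s -> \sum_(x <- s) a x <= sup_sum a.
Proof.
move=> sa us; apply: ub_le_sup => //; by exists s.
Qed.

Lemma sum_bounded_bound a M :
  (forall s, uniq s -> \sum_(x <- s) a x <= M) -> sum_bounded a.
Proof. by move=> aM; exists M => _ [s us <-]; exact: aM. Qed.

Lemma sup_sum_le a M :
  (forall s, uniq s -> \sum_(x <- s) a x <= M) -> sup_sum a <= M.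
Proof.
move=> aM; apply: ge_sup; first exact: partial_sums_nonempty.
by move=> _ [s us <-]; exact: aM.
Qed.

Lemma sup_sum_ge0 a : sum_bounded a -> 0 <= sup_sum a.
Proof. by move=> /(@sup_sum_ub _ [::])-/(_ isT); rewrite big_nil. Qed.

Lemma sup_sum_mono a b : (forall x, a x <= b x) -> sum_bounded b ->
  sup_sum a <= sup_sum b.
Proof.
move=> ab sb; apply: sup_sum_le => s us.
by apply: le_trans (sup_sum_ub sb us); exact: ler_sum.
Qed.

Lemma le_sum_bounded a b : (forall x, a x <= b x) -> sum_bounded b -> sum_bounded a.
Proof.
move=> ab sb; apply: (@sum_bounded_bound _ (sup_sum b)) => s us.
by apply: le_trans (sup_sum_ub sb us); exact: ler_sum.
Qed.

Lemma sum_boundedD a b : sum_bounded a -> sum_bounded b ->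
  sum_bounded (fun x => a x + b x).
Proof.
move=> sa sb; apply: (@sum_bounded_bound _ (sup_sum a + sup_sum b)) => s us.
by rewrite big_split lerD ?sup_sum_ub.
Qed.

Lemma sum_boundedZ c a : 0 <= c -> sum_bounded a -> sum_bounded (fun x => c * a x).
Proof.
move=> c0 sa; apply: (@sum_bounded_bound _ (c * sup_sum a)) => s us.
by rewrite -mulr_sumr ler_wpM2l ?sup_sum_ub.
Qed.

Lemma sup_sum0 : sup_sum (fun=> 0) = 0.
Proof.
apply/le_anti/andP; split; first by apply: sup_sum_le => s us; rewrite big1.
apply/sup_sum_ge0/(@sum_bounded_bound _ 0) => s us; by rewrite big1.
Qed.

Lemma sum_subseq_le a s t : (forall x, 0 <= a x) -> uniq s -> uniq t ->
  {subset s <= t} -> \sum_(x <- s) a x <= \sum_(x <- t) a x.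
Proof.
move=> a0 us ut st.
have -> : \sum_(x <- s) a x = \sum_(x <- t | x \in s) a x.
  rewrite -[RHS]big_filter; apply: perm_big; apply: uniq_perm => //.
    exact: filter_uniq.
  by move=> x; rewrite mem_filter; case: (boolP (x \in s)) => //= /st ->.
rewrite [leRHS](bigID (mem s)) /= lerDl; exact: sumr_ge0.
Qed.

Lemma sup_sumD a b : (forall x, 0 <= a x) -> (forall x, 0 <= b x) ->
  sum_bounded a -> sum_bounded b ->
  sup_sum (fun x => a x + b x) = sup_sum a + sup_sum b.
Proof.
move=> a0 b0 sa sb; apply/le_anti/andP; split.
  by apply: sup_sum_le => s us; rewrite big_split lerD ?sup_sum_ub.
rewrite -lerBrDr; apply: sup_sum_le => s us.
rewrite lerBrDr -lerBrDl; apply: sup_sum_le => t ut.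
rewrite lerBrDl.
(* Nonnegativity lets both finite sums be enlarged to the union of their supports, where they add up
   to one partial sum of a + b. *)
have uu := undup_uniq (s ++ t).
apply: le_trans (sup_sum_ub (sum_boundedD sa sb) uu).
rewrite big_split lerD //; apply: sum_subseq_le => // x xs;
  by rewrite mem_undup mem_cat xs ?orbT.
Qed.

Lemma sup_sumZ c a : 0 <= c -> sum_bounded a ->
  sup_sum (fun x => c * a x) = c * sup_sum a.
Proof.
rewrite le_eqVlt => /predU1P[<- _|c0 sa].
  by rewrite mul0r -[RHS]sup_sum0; congr sup_sum; apply/funext => x; rewrite mul0r.
have c0' := ltW c0.
apply/le_anti/andP; split.
  by apply: sup_sum_le => s us; rewrite -mulr_sumr ler_wpM2l ?sup_sum_ub.
rewrite mulrC -ler_pdivlMr //; apply: sup_sum_le => s us.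
rewrite ler_pdivlMr // mulrC mulr_sumr; apply: sup_sum_ub => //.
exact: sum_boundedZ.
Qed.

Lemma sum_bounded_reindex a (f : X -> X) : injective f ->
  sum_bounded a -> sum_bounded (a \o f).
Proof.
move=> fI sa; apply: (@sum_bounded_bound _ (sup_sum a)) => s us.
rewrite -(big_map f xpredT a); apply: sup_sum_ub => //; by rewrite map_inj_uniq.
Qed.

Lemma sup_sum_reindex a (f g : X -> X) : cancel f g -> cancel g f ->
  sum_bounded a -> sup_sum (a \o f) = sup_sum a.
Proof.
move=> fK gK sa; have fI := can_inj fK; have gI := can_inj gK.
apply/le_anti/andP; split; apply: sup_sum_le => s us.
  rewrite -(big_map f xpredT a); apply: sup_sum_ub => //; by rewrite map_inj_uniq.
have -> : \sum_(x <- s) a x = \sum_(x <- map g s) (a \o f) x.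
  by rewrite big_map; apply: eq_bigr => x _; rewrite /= gK.
apply: sup_sum_ub; first exact: sum_bounded_reindex.
by rewrite map_inj_uniq.
Qed.

Definition abs_summable a := sum_bounded (fun x => `|a x|).

(* a is split as (|a| + a) - |a|: unlike with positive and negative parts, both
   terms are additive up to terms of the same shape, so linearity is formal. *)
Definition signed_sum a : R :=
  sup_sum (fun x => `|a x| + a x) - sup_sum (fun x => `|a x|).

Lemma abs_summable_pos a : abs_summable a -> sum_bounded (fun x => `|a x| + a x).
Proof.
move=> sa; apply: le_sum_bounded (sum_boundedD sa sa) => x.
by rewrite lerD2l ler_norm.
Qed.

Lemma abs_summableD a b : abs_summable a -> abs_summable b ->
  abs_summable (fun x => a x + b x).
Proof.
move=> sa sb; apply: le_sum_bounded (sum_boundedD sa sb) => x; exact: ler_normD.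
Qed.

Lemma abs_summableZ c a : abs_summable a -> abs_summable (fun x => c * a x).
Proof.
move=> sa; apply: le_sum_bounded (sum_boundedZ (normr_ge0 c) sa) => x.
by rewrite normrM.
Qed.

Lemma signed_sum_ge0E a : (forall x, 0 <= a x) -> sum_bounded a ->
  signed_sum a = sup_sum a.
Proof.
move=> a0 sa; rewrite /signed_sum.
have -> : (fun x => `|a x|) = a by apply/funext => x; rewrite ger0_norm.
have -> : (fun x => `|a x| + a x) = (fun x => a x + a x).
  by apply/funext => x; rewrite ger0_norm.
by rewrite sup_sumD // addrK.
Qed.

Lemma signed_sumD a b : abs_summable a -> abs_summable b ->
  signed_sum (fun x => a x + b x) = signed_sum a + signed_sum b.
Proof.
move=> sa sb; have sab := abs_summableD sa sb.
have pos (c' : X -> R) : forall x : X, 0 <= `|c' x| + c' x :> R.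
  by move=> x; rewrite -lerBlDr sub0r -normrN ler_norm.
have sp := abs_summable_pos.
have nn (c' : X -> R) : forall x, 0 <= `|c' x| by move=> x.
pose p x := `|a x + b x| + (a x + b x).
(* All summands on both sides are nonnegative, so [sup_sumD] splits each side, and the claim is a
   linear rearrangement. *)
have : sup_sum (fun x => p x + (`|a x| + `|b x|))
  = sup_sum (fun x => `|a x + b x| + ((`|a x| + a x) + (`|b x| + b x))).
  congr sup_sum; apply/funext => x; rewrite /p; ring.
have pa := pos a; have pb := pos b; have spa := sp a sa; have spb := sp b sb.
have pab : forall x, 0 <= p x := pos (fun x => a x + b x).
have spab : sum_bounded p := sp (fun x => a x + b x) sab.
have nab x : 0 <= `|a x| + `|b x| by rewrite addr_ge0.
have pab' x : 0 <= (`|a x| + a x) + (`|b x| + b x) by rewrite addr_ge0.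
have snab := sum_boundedD sa sb; have spab' := sum_boundedD spa spb.
have := sup_sumD (nn a) (nn b) sa sb.
have := sup_sumD pa pb spa spb.
have := sup_sumD pab nab spab snab.
have := sup_sumD (nn (fun x => a x + b x)) pab' sab spab'.
rewrite /signed_sum -/p => -> -> -> -> e; lra.
Qed.

Lemma signed_sum0 : signed_sum (fun=> 0) = 0.
Proof.
rewrite /signed_sum normr0.
rewrite (_ : (fun=> 0 + 0) = (fun=> 0)) ?subrr//.
by apply/funext => x; rewrite addr0.
Qed.

Lemma signed_sumZ c a : abs_summable a ->
  signed_sum (fun x => c * a x) = c * signed_sum a.
Proof.
have pos c' a' : 0 <= c' -> abs_summable a' ->
    signed_sum (fun x => c' * a' x) = c' * signed_sum a'.
  move=> c0 sa; rewrite /signed_sum mulrBr -!sup_sumZ//.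
    congr (sup_sum _ - sup_sum _); apply/funext => x;
    by rewrite normrM (ger0_norm c0) ?mulrDr.
  exact: abs_summable_pos.
move=> sa; have [c0|c0] := leP 0 c; first exact: pos.
have nc : 0 <= - c by rewrite oppr_ge0 ltW.
(* For c < 0, the families c a and (- c) a cancel termwise, which reduces the claim to the
   nonnegative scalar - c. *)
have := signed_sumD (abs_summableZ c sa) (abs_summableZ (- c) sa).
rewrite (pos _ _ nc sa).
have -> : (fun x => c * a x + - c * a x) = (fun=> 0) by apply/funext => x; ring.
by rewrite signed_sum0 => e; lra.
Qed.

Lemma signed_sum_reindex a (f g : X -> X) : cancel f g -> cancel g f ->
  abs_summable a -> signed_sum (a \o f) = signed_sum a.
Proof.
move=> fK gK sa.
rewrite /signed_sum -(sup_sum_reindex fK gK sa).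
by rewrite -(sup_sum_reindex fK gK (abs_summable_pos sa)).
Qed.

End UnorderedSums.

(** * The Hilbert space of square-summable functions *)

Section SquareSummable.
Variables (R : realType) (X : choiceType).

Definition normSq (z : R[i]) : R := Re z ^+ 2 + Im z ^+ 2.

Lemma normSq_ge0 z : 0 <= normSq z.
Proof. by rewrite addr_ge0 ?sqr_ge0. Qed.

Lemma normSqM z w : normSq (z * w) = normSq z * normSq w.
Proof. by case: z w => [a b] [c d]; rewrite /normSq/=; ring. Qed.

Lemma normSq_eq0 z : normSq z = 0 -> z = 0.
Proof.
case: z => a b /eqP; rewrite /normSq /= paddr_eq0 ?sqr_ge0// !sqrf_eq0.
by move=> /andP[/eqP-> /eqP->].
Qed.

(** In each real coordinate the gap between the two sides is the square t (x - y / t)^2. The case t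
    = 1 gives closure under addition; a tuned t gives the triangle inequality. *)
Lemma normSqD_le (t : R) z w : 0 < t ->
  normSq (z + w) <= (1 + t) * normSq z + (1 + t^-1) * normSq w.
Proof.
have le_sq (x y : R) : 0 < t ->
    (x + y) ^+ 2 <= (1 + t) * x ^+ 2 + (1 + t^-1) * y ^+ 2.
  move=> t0; rewrite -subr_ge0.
  have -> : (1 + t) * x ^+ 2 + (1 + t^-1) * y ^+ 2 - (x + y) ^+ 2
     = t * (x - y / t) ^+ 2 by field; rewrite gt_eqF.
  by rewrite mulr_ge0 ?sqr_ge0 ?ltW.
case: z w => [a b] [c d] t0; rewrite /normSq /=.
apply: le_trans (lerD (le_sq a c t0) (le_sq b d t0)) _.
by rewrite le_eqVlt; apply/orP; left; apply/eqP; ring.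
Qed.

(** A boolean predicate, so that [l2] inherits its module structure as a subtype of the function
    space. *)
Definition square_summable : {pred (X -> R[i])} :=
  fun f => `[< sum_bounded (normSq \o f) >].

Fact square_summable_submod : submod_closed square_summable.
Proof.
split.
  apply/asboolP; apply: (@sum_bounded_bound _ _ _ 0) => s _.
  by rewrite big1// => x _; rewrite /normSq /= !expr0n /= addr0.
move=> c f g /asboolP sf /asboolP sg; apply/asboolP.
apply: (@le_sum_bounded _ _ _
  (fun x => (2 * normSq c) * normSq (f x) + 2 * normSq (g x))) => [x|].
  apply: le_trans (normSqD_le _ _ ltr01) _.
  by rewrite invr1 normSqM mulrA.
by apply: sum_boundedD; apply: sum_boundedZ => //; rewrite mulr_ge0 ?normSq_ge0.
Qed.

HB.instance Definition _ :=
  GRing.isSubmodClosed.Build R[i] (X -> R[i]) square_summable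
    square_summable_submod.

Record l2 := L2 { l2_fun :> X -> R[i]; l2P : l2_fun \in square_summable }.

HB.instance Definition _ := [isSub for l2_fun].
HB.instance Definition _ := [Choice of l2 by <:].
HB.instance Definition _ := [SubChoice_isSubLmodule of l2 by <:].

Lemma l2_ext (f g : l2) : f =1 g -> f = g.
Proof. by move=> fg; apply/val_inj/funext. Qed.

Lemma l2_sum_bounded (f : l2) : sum_bounded (normSq \o f).
Proof. by case: f => f /= /asboolP. Qed.

Lemma l2_add (f g : l2) x : (f + g) x = f x + g x. Proof. by []. Qed.
Lemma l2_scale c (f : l2) x : (c *: f) x = c * f x. Proof. by []. Qed.
Lemma l2_opp (f : l2) x : (- f) x = - f x. Proof. by []. Qed.
Lemma l2_zero x : (0 : l2) x = 0. Proof. by []. Qed.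

(** A crude bound obtained by expanding squares of sums and differences of coordinates; it makes the
    series of the inner product absolutely summable. *)
Lemma mul_conj_bound (z w : R[i]) :
  `|Re (z * w^*)| <= normSq z + normSq w /\
  `|Im (z * w^*)| <= normSq z + normSq w.
Proof.
case: z w => [a b] [c d]; rewrite /normSq /= !ler_norml.
have := (sqr_ge0 (a + c), sqr_ge0 (a - c), sqr_ge0 (b + d), sqr_ge0 (b - d)).
have := (sqr_ge0 (a + d), sqr_ge0 (a - d), sqr_ge0 (b + c), sqr_ge0 (b - c)).
have := (sqr_ge0 a, sqr_ge0 b, sqr_ge0 c, sqr_ge0 d).
rewrite !sqrrD !sqrrN !mulrN => -[[[? ?] ?] ?] [[[? ?] ?] ?] [[[? ?] ?] ?].
by split; lra.
Qed.

Definition l2_inner (f g : l2) : R[i] :=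
  signed_sum (fun x => Re (f x * (g x)^*)) +i*
  signed_sum (fun x => Im (f x * (g x)^*)).

Lemma l2_inner_diag f : l2_inner f f = (sup_sum (normSq \o f))%:C.
Proof.
rewrite /l2_inner; congr Complex.
  rewrite -signed_sum_ge0E; first last.
  - exact: l2_sum_bounded.
  - by move=> x; exact: normSq_ge0.
  - congr signed_sum; apply/funext => x /=; case: (f x) => a b.
    by rewrite /normSq /=; ring.
rewrite -[RHS](signed_sum0 _ X); congr signed_sum; apply/funext => x.
by case: (f x) => a b /=; ring.
Qed.

Lemma abs_summable_Re (f g : l2) : abs_summable (fun x => Re (f x * (g x)^*)).
Proof.
apply: le_sum_bounded (sum_boundedD (l2_sum_bounded f) (l2_sum_bounded g)) => x.
exact: (mul_conj_bound _ _).1.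
Qed.

Lemma abs_summable_Im (f g : l2) : abs_summable (fun x => Im (f x * (g x)^*)).
Proof.
apply: le_sum_bounded (sum_boundedD (l2_sum_bounded f) (l2_sum_bounded g)) => x.
exact: (mul_conj_bound _ _).2.
Qed.

Lemma l2_inner_conj f g : l2_inner f g = (l2_inner g f)^*.
Proof.
rewrite /l2_inner /=; congr Complex.
  by congr signed_sum; apply/funext => x; case: (f x) (g x) => a b [c d] /=; ring.
rewrite -mulN1r -signed_sumZ; last exact: abs_summable_Im.
by congr signed_sum; apply/funext => x; case: (f x) (g x) => a b [c d] /=; ring.
Qed.

Lemma l2_innerDl h : {morph l2_inner^~ h : f g / f + g}.
Proof.
move=> f g; rewrite /l2_inner; congr Complex.
  rewrite -signed_sumD; try exact: abs_summable_Re.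
  congr signed_sum; apply/funext => x; rewrite l2_add.
  by case: (f x) (g x) (h x) => a b [c d] [u v] /=; ring.
rewrite -signed_sumD; try exact: abs_summable_Im.
congr signed_sum; apply/funext => x; rewrite l2_add.
by case: (f x) (g x) (h x) => a b [c d] [u v] /=; ring.
Qed.

Lemma l2_innerZl h : scalable_for *%R (l2_inner^~ h).
Proof.
move=> [p q] f; rewrite /l2_inner; congr Complex.
  rewrite -mulNr -!signed_sumZ -?signed_sumD;
    try by [exact: abs_summable_Re | exact: abs_summable_Im |
     apply/abs_summableZ/abs_summable_Re | apply/abs_summableZ/abs_summable_Im].
  congr signed_sum; apply/funext => x; rewrite l2_scale.
  by case: (f x) (h x) => a b [u v] /=; ring.
rewrite -!signed_sumZ -?signed_sumD;
  try by [exact: abs_summable_Re | exact: abs_summable_Im |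
     apply/abs_summableZ/abs_summable_Re | apply/abs_summableZ/abs_summable_Im].
congr signed_sum; apply/funext => x; rewrite l2_scale.
by case: (f x) (h x) => a b [u v] /=; ring.
Qed.

Lemma l2_innerBl h : {morph l2_inner^~ h : f g / f - g}.
Proof. by move=> f g; rewrite l2_innerDl -scaleN1r l2_innerZl mulN1r. Qed.

Lemma l2_innerBr f : {morph l2_inner f : g h / g - h}.
Proof.
move=> g h; rewrite !(l2_inner_conj f) l2_innerBl; exact: rmorphB.
Qed.

Lemma l2_innerZr f : scalable_for (@Num.conj R[i] \; *%R) (l2_inner f).
Proof.
move=> c g; rewrite !(l2_inner_conj f) l2_innerZl; exact: rmorphM.
Qed.

HB.instance Definition _ := @isBilinear.Build R[i] l2 l2 R[i] *%R
  (@Num.conj R[i] \; *%R) l2_inner l2_innerBl l2_innerBr l2_innerZl l2_innerZr.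

Fact l2_inner_hermitian f g :
  l2_inner f g = (-1) ^+ false * Num.conj (l2_inner g f).
Proof. by rewrite mul1r l2_inner_conj. Qed.

HB.instance Definition _ := isHermitianSesquilinear.Build
  R[i] l2 false (@Num.conj R[i]) l2_inner l2_inner_hermitian.

Lemma sup_normSq_eq0 (f : l2) : sup_sum (normSq \o f) = 0 -> f = 0.
Proof.
move=> f0; apply/l2_ext => x; rewrite l2_zero; apply/normSq_eq0/le_anti.
rewrite normSq_ge0 andbT -f0.
by have := @sup_sum_ub _ _ _ [:: x] (l2_sum_bounded f) isT; rewrite big_seq1.
Qed.

Lemma sup_normSq_ge0 (f : l2) : 0 <= sup_sum (normSq \o f).
Proof. exact/sup_sum_ge0/l2_sum_bounded. Qed.

Fact l2_inner_gt0 f : f != 0 -> 0 < l2_inner f f.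
Proof.
move=> f0; rewrite l2_inner_diag ltcR lt_def sup_normSq_ge0 andbT.
by apply: contraNneq f0 => /sup_normSq_eq0 ->.
Qed.

HB.instance Definition _ := isDotProduct.Build R[i] l2 l2_inner l2_inner_gt0.

(** * The norm of l2 *)

Definition l2_norm (f : l2) : R := Num.sqrt (sup_sum (normSq \o f)).

Lemma l2_norm_sqr f : l2_norm f ^+ 2 = sup_sum (normSq \o f).
Proof. by rewrite sqr_sqrtr // sup_normSq_ge0. Qed.

Lemma l2_norm_ge0 f : 0 <= l2_norm f. Proof. exact: sqrtr_ge0. Qed.

Lemma l2_norm_eq0 f : l2_norm f = 0 -> f = 0.
Proof. by move=> f0; apply: sup_normSq_eq0; rewrite -l2_norm_sqr f0 expr0n. Qed.

Lemma l2_norm_gt0 f : f != 0 -> 0 < l2_norm f.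
Proof.
move=> f0; rewrite lt_def l2_norm_ge0 andbT.
by apply: contraNneq f0 => /l2_norm_eq0 ->.
Qed.

(* Minkowski without Cauchy-Schwarz: normSqD_le is summed with the weight t for
   which it is sharp, t = |g| / |f|. *)
Lemma l2_normD f g : l2_norm (f + g) <= l2_norm f + l2_norm g.
Proof.
have := l2_norm_ge0 f; rewrite le_eqVlt => /predU1P[/esym/l2_norm_eq0 ->|f0].
  by rewrite add0r lerDr l2_norm_ge0.
have := l2_norm_ge0 g; rewrite le_eqVlt => /predU1P[/esym/l2_norm_eq0 ->|g0].
  by rewrite addr0 lerDl l2_norm_ge0.
rewrite -ler_sqr ?nnegrE ?addr_ge0 ?l2_norm_ge0// l2_norm_sqr.
pose t := l2_norm g / l2_norm f; have t0 : 0 < t by rewrite divr_gt0.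
have -> : (l2_norm f + l2_norm g) ^+ 2 =
    (1 + t) * l2_norm f ^+ 2 + (1 + t^-1) * l2_norm g ^+ 2.
  by rewrite /t; field; rewrite !gt_eqF.
have t1 : 0 <= 1 + t by rewrite addr_ge0 ?ltW.
have t2 : 0 <= 1 + t^-1 by rewrite addr_ge0 // invr_ge0 ltW.
have sf := l2_sum_bounded f; have sg := l2_sum_bounded g.
rewrite !l2_norm_sqr -!sup_sumZ// -sup_sumD; first last.
- exact: sum_boundedZ.
- exact: sum_boundedZ.
- by move=> x; rewrite mulr_ge0 ?normSq_ge0.
- by move=> x; rewrite mulr_ge0 ?normSq_ge0.
apply: sup_sum_mono; last by apply: sum_boundedD; exact: sum_boundedZ.
by move=> x; exact: normSqD_le.
Qed.

Lemma l2_normZ c f : l2_norm (c *: f) = Num.sqrt (normSq c) * l2_norm f.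
Proof.
rewrite /l2_norm -sqrtrM ?normSq_ge0// -sup_sumZ ?normSq_ge0//; last first.
  exact: l2_sum_bounded.
by congr (Num.sqrt (sup_sum _)); apply/funext => x; rewrite -normSqM.
Qed.

Fact l2_normD_complex f g : (l2_norm (f + g))%:C <= (l2_norm f)%:C + (l2_norm g)%:C.
Proof. by rewrite -rmorphD lecR l2_normD. Qed.

Fact l2_normZ_complex c f : (l2_norm (c *: f))%:C = `|c| * (l2_norm f)%:C.
Proof. by rewrite l2_normZ rmorphM normc_def. Qed.

Fact l2_norm_complex_eq0 f : (l2_norm f)%:C = 0 -> f = 0.
Proof. by case=> /l2_norm_eq0. Qed.

HB.instance Definition _ := Lmodule_isNormed.Build R[i] l2
  l2_normD_complex l2_normZ_complex l2_norm_complex_eq0.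

Lemma l2_normE f : `|f| = (l2_norm f)%:C. Proof. by []. Qed.

(** * Completeness of l2 *)

Lemma l2_pt_le (f : l2) x : normSq (f x) <= l2_norm f ^+ 2.
Proof.
rewrite l2_norm_sqr.
by have := @sup_sum_ub _ _ _ [:: x] (l2_sum_bounded f) isT; rewrite big_seq1.
Qed.

Lemma l2_cauchy (F : set_system l2) : ProperFilter F -> cauchy F ->
  forall e : R, 0 < e ->
  exists2 A, F A & forall f g, A f -> A g -> l2_norm (f - g) < e.
Proof.
move=> FF /cauchy_ballP Fc e e0.
have /Fc [[A B] /= [FA FB] AB] : 0 < e%:C by rewrite ltcR.
exists (A `&` B) => [|f g [Af _] [_ Bg]]; first exact: filterI.
have := AB (f, g) (conj Af Bg).
by rewrite -ball_normE /ball_ /= l2_normE ltcR.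
Qed.

(** Here [p] stands for [Re] or [Im]: evaluation followed by [p] is 1-Lipschitz, so it sends F to a
    Cauchy filter on R, which converges. *)
Lemma l2_cauchy_part (F : set_system l2) (p : R[i] -> R) x : ProperFilter F ->
  (forall z w, p (z - w) = p z - p w) ->
  (forall z, p z ^+ 2 <= normSq z) ->
  cauchy F -> cvg ((fun f : l2 => p (f x)) @ F).
Proof.
move=> FF pB pn Fc; apply/cauchy_cvgP/cauchy_ballP => e e0.
have [A FA hA] := l2_cauchy FF Fc e0.
pose v (f : l2) := p (f x).
have FA' : F (v @^-1` (v @` A)) by apply: filterS FA => f Af; exists f.
exists (v @` A, v @` A); first by [].
move=> [_ _] /= [[f Af <-] [g Ag <-]].
rewrite -ball_normE /ball_ /= -pB -[f x - g x]/((f - g) x).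
apply: le_lt_trans (hA _ _ Af Ag).
rewrite -ler_sqr ?nnegrE ?l2_norm_ge0// real_normK ?num_real//.
exact: le_trans (pn _) (l2_pt_le _ _).
Qed.

Lemma l2_pointwise_lim (F : set_system l2) (x : X) : ProperFilter F -> cauchy F ->
  exists l : R[i], forall e : R, 0 < e ->
    \forall f \near F, normSq ((f : l2) x - l) < e.
Proof.
move=> FF Fc.
have cR : cvg ((fun f : l2 => Re (f x)) @ F).
  by apply: l2_cauchy_part => // [[a b] [c d]//|[a b]]; rewrite lerDl sqr_ge0.
have cI : cvg ((fun f : l2 => Im (f x)) @ F).
  by apply: l2_cauchy_part => // [[a b] [c d]//|[a b]]; rewrite lerDr sqr_ge0.
exists (lim ((fun f : l2 => Re (f x)) @ F) +i* lim ((fun f : l2 => Im (f x)) @ F)).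
move=> e e0; pose d := Num.sqrt (e / 2).
have d0 : 0 < d by rewrite sqrtr_gt0 divr_gt0.
have sqlt (u v : R) : `|u - v| < d -> (v - u) ^+ 2 < e / 2.
  rewrite distrC -ltr_sqr ?nnegrE ?normr_ge0 ?(ltW d0)//.
  rewrite real_normK ?num_real// sqr_sqrtr//.
  by rewrite divr_ge0 // ltW.
near=> f.
have h1 : `|lim ((fun f : l2 => Re (f x)) @ F) - Re (f x)| < d.
  by near: f; move/cvgrPdist_lt : cR; apply.
have h2 : `|lim ((fun f : l2 => Im (f x)) @ F) - Im (f x)| < d.
  by near: f; move/cvgrPdist_lt : cI; apply.
rewrite [e]splitr; move: (sqlt _ _ h1) (sqlt _ _ h2); rewrite /normSq.
case: (f x) => a b /= ha hb; exact: ltrD.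
Unshelve. all: by end_near.
Qed.

Fact l2_complete (F : set_system l2) : ProperFilter F -> cauchy F -> cvg F.
Proof.
move=> FF Fc; have [l hl] := choice (fun x => l2_pointwise_lim x FF Fc).
have near_sum s e : 0 < e ->
    \forall f \near F, \sum_(x <- s) normSq ((f : l2) x - l x) < e.
  elim: s e => [|y s IHs] e e0.
    by apply: nearW => f; rewrite big_nil.
  have e2 : 0 < e / 2 by rewrite divr_gt0.
  apply: filterS2 (hl y _ e2) (IHs _ e2) => f h1 h2.
  by rewrite big_cons [e]splitr ltrD.
(* On a finite s, g is compared with some h in A that is close to l on s: the squares of g - h and h
   - l each sum to at most e^2, and [normSqD_le] with t = 1 doubles both. The set A does not depend
   on s. *)
have bound e : 0 < e -> exists2 A, F A & forall g, A g -> forall s, uniq s ->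
    \sum_(x <- s) normSq (g x - l x) <= 4 * e ^+ 2.
  move=> e0; have [A FA hA] := l2_cauchy FF Fc e0.
  exists A => // g Ag s us.
  have e20 : 0 < e ^+ 2 by rewrite exprn_gt0.
  have [h [Ah hs]] := filter_ex (filterI FA (near_sum s _ e20)).
  apply: (@le_trans _ _ (\sum_(x <- s) (2 * normSq ((g - h) x) +
                                      2 * normSq (h x - l x)))).
    apply: ler_sum => x _; have := normSqD_le (g x - h x) (h x - l x) ltr01.
    by rewrite invr1 addrA subrK.
  rewrite big_split -!mulr_sumr.
  have -> : 4 * e ^+ 2 = 2 * e ^+ 2 + 2 * e ^+ 2 by ring.
  apply: lerD; rewrite ler_pM2l//; last exact: ltW.
  apply: le_trans (sup_sum_ub (l2_sum_bounded (g - h)) us) _.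
  by rewrite -l2_norm_sqr ler_sqr ?nnegrE ?l2_norm_ge0 ?(ltW e0)// ltW// hA.
have [A FA hA] := bound 1 ltr01; have [g Ag] := filter_ex FA.
have dl : (fun x => g x - l x) \in square_summable.
  by apply/asboolP/(@sum_bounded_bound _ _ _ (4 * 1 ^+ 2)) => s; exact: hA.
(* The pointwise limit l lies in l2 because both g and g - l do. *)
pose L : l2 := g - L2 dl.
have LE x : L x = l x by rewrite /L l2_add l2_opp /= opprB addrC subrK.
apply/cvg_ex; exists L; apply/cvgrPdist_le => e e0.
(* A positive element of R[i] is real; the factor 2 matches the square root of the constant 4 in
   [bound]. *)
have [r r0 er] : exists2 r, 0 < r & e = (2 * r)%:C.
  move: e0; case: e => a b; rewrite ltcE /= => /andP[/eqP -> a0].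
  by exists (a / 2); rewrite ?divr_gt0// mulrC divfK.
have [B FB hB] := bound _ r0.
apply: filterS FB => f Bf; rewrite distrC l2_normE er lecR.
rewrite -ler_sqr ?nnegrE ?l2_norm_ge0 ?mulr_ge0 ?(ltW r0)// l2_norm_sqr.
rewrite exprMn -natrX; apply: sup_sum_le => s us.
apply: le_trans (hB _ Bf s us); apply: ler_sum => x _.
by rewrite -LE.
Qed.

HB.instance Definition _ := Uniform_isComplete.Build l2 l2_complete.

Fact l2_innerE (f : l2) : l2_inner f f = `|f| ^+ 2.
Proof. by rewrite l2_inner_diag l2_normE -rmorphXn -l2_norm_sqr. Qed.

Definition l2_hilbert : hilbert_space R :=
  @HilbertSpace R l2 l2_inner l2_innerE.

End SquareSummable.

(** * Permutation representations *)

Section PermutationRepresentation.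
Variables (R : realType) (G : groupType) (X : choiceType) (act : G -> X -> X).
Hypothesis act1 : forall x, act 1%g x = x.
Hypothesis actM : forall g h x, act (g * h)%g x = act g (act h x).

Lemma actK g : cancel (act g) (act g^-1%g).
Proof. by move=> x; rewrite -actM mulVg act1. Qed.

Lemma actVK g : cancel (act g^-1%g) (act g).
Proof. by move=> x; rewrite -actM mulgV act1. Qed.

Fact translate_subproof g (f : l2 R X) :
  (fun x => f (act g^-1%g x)) \in @square_summable R X.
Proof.
apply/asboolP.
apply: (@sum_bounded_reindex _ _ (@normSq R \o f) _ (can_inj (actVK g))).
exact: l2_sum_bounded.
Qed.

Definition translate g (f : l2 R X) : l2 R X := L2 (translate_subproof g f).

Fact translate_linear g : linear (translate g).
Proof. by move=> c f h; exact: l2_ext. Qed.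

HB.instance Definition _ g :=
  GRing.isLinear.Build R[i] (l2 R X) (l2 R X) *:%R (translate g)
    (translate_linear g).

Fact translate1 f : translate 1%g f = f.
Proof. by apply: l2_ext => x /=; rewrite invg1 act1. Qed.

Fact translateM g h f : translate (g * h)%g f = translate g (translate h f).
Proof. by apply: l2_ext => x /=; rewrite invgM actM. Qed.

Fact translate_inner g f h :
  l2_inner (translate g f) (translate g h) = l2_inner f h.
Proof.
rewrite /l2_inner; congr Complex.
  exact: (signed_sum_reindex (actVK g) (actK g) (abs_summable_Re f h)).
exact: (signed_sum_reindex (actVK g) (actK g) (abs_summable_Im f h)).
Qed.

Definition permutation_rep : unitary_rep G (l2_hilbert R X) :=
  @UnitaryRep R G (l2_hilbert R X) (fun g => translate g)
    translate1 translateM translate_inner.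

Fact delta_subproof x0 :
  (fun x : X => (x == x0)%:R : R[i]) \in @square_summable R X.
Proof.
apply/asboolP; apply: (@sum_bounded_bound _ _ _ 1) => s us.
rewrite (eq_bigr (fun x => if x == x0 then 1 else 0)); last first.
  move=> x _; rewrite /= /normSq.
  by case: eqP => _ /=; rewrite ?expr1n ?expr0n ?addr0.
rewrite -big_mkcond; case: (boolP (x0 \in s)) => [xs|xs].
  by rewrite -big_filter filter_pred1_uniq// big_seq1.
by rewrite big_seq_cond big1// => x /andP[/[swap] /eqP ->]; rewrite (negPf xs).
Qed.

Definition delta x0 : l2 R X := L2 (delta_subproof x0).

Lemma delta_neq0 x0 : delta x0 != 0.
Proof.
apply/eqP => /(congr1 (fun f : l2 R X => f x0)) /=.
by rewrite eqxx => /eqP; rewrite oner_eq0.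
Qed.

Lemma translate_delta g x0 : act g x0 = x0 -> translate g (delta x0) = delta x0.
Proof.
move=> gx; apply: l2_ext => x.
(* Applying g to both sides turns g^-1 x = x0 into x = g x0 = x0. *)
by rewrite /= -(can_eq (actK g) (act g^-1%g x) x0) actVK gx.
Qed.

Hypothesis infinite_orbits : forall x (s : seq X), exists g, act g x \notin s.

(** Greedy choice: some point of the orbit always avoids the list built so far. *)
Lemma orbit_seq x n : exists s : seq X,
  [/\ uniq s, size s = n & forall y, y \in s -> exists g, y = act g x].
Proof.
elim: n => [|n [s [us sn sx]]]; first by exists [::].
have [g gs] := infinite_orbits x s; exists (act g x :: s).
split=> /=; [by rewrite gs | by rewrite sn |].
by move=> y; rewrite inE => /predU1P[->|/sx//]; exists g.
Qed.

Lemma invariant_eq0 (f : l2 R X) : (forall g, translate g f = f) -> f = 0.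
Proof.
move=> finv; apply: l2_ext => x; apply/normSq_eq0/eqP; apply: contraT => fx.
have {}fx : 0 < normSq (f x) by rewrite lt_def fx normSq_ge0.
(* The length exceeds the squared norm of f divided by |f x|^2, so a partial sum of that many equal
   terms is too large. *)
have [s [us sn sx]] :=
  orbit_seq x (Num.truncn (sup_sum (@normSq R \o f) / normSq (f x))).+1.
have := sup_sum_ub (l2_sum_bounded f) us.
rewrite big_seq (eq_bigr (fun=> normSq (f x))); last first.
  (* Invariance at g x reads f (g x) = f (g^-1 (g x)) = f x. *)
  move=> y /sx[g ->]; rewrite /= -[in LHS](finv g) /=; by rewrite actK.
rewrite -big_seq big_const_seq count_predT iter_addr_0 sn.
rewrite -mulr_natl -ler_pdivlMr// leNgt truncnS_gt//.
Qed.

Hypothesis finite_fixpoints :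
  forall Q : seq G, exists x, forall g, g \in Q -> act g x = x.

Lemma not_property_T : ~ property_T R G.
Proof.
case=> Q [eps [eps0 /(_ _ permutation_rep)]] [].
  have [x xQ] := finite_fixpoints Q; exists (delta x); split.
    exact: delta_neq0.
  (* The displacement is exactly 0, so only positivity of eps and of the norm of the delta function
     remains. *)
  move=> g /xQ gx; rewrite /= translate_delta// subrr normr0.
  by apply: mulr_gt0; rewrite ltcR ?l2_norm_gt0 ?delta_neq0.
by move=> f [/eqP f0] /invariant_eq0.
Qed.

End PermutationRepresentation.

(** * Conjugation on the nontrivial elements *)

Section Conjugation.
Local Open Scope group_scope.
Variable G : groupType.

Lemma conjugate_neq1 (g : G) (x : {x : G | x != 1}) : g * val x * g^-1 != 1.
Proof.
apply: contra (valP x) => /eqP h; apply/eqP.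
by apply: (mulgI g); apply: (mulIg g^-1); rewrite h mulg1 mulgV.
Qed.

(** The identity is excluded because it is a one-point orbit, whose delta function would be
    invariant. *)
Definition conjugate (g : G) (x : {x : G | x != 1}) : {x : G | x != 1} :=
  Sub (g * val x * g^-1) (conjugate_neq1 g x).

End Conjugation.

Theorem proposition2p2p7 (R : realType) (G : groupType) :
  existentially_closed G -> ~ property_T R G.
Proof.
move=> ecG; apply: (@not_property_T R G {x : G | x != 1%g} (@conjugate G)).
- by move=> x; apply: val_inj; rewrite /= mul1g invg1 mulg1.
- by move=> g h x; apply: val_inj; rewrite /= invgM !mulgA.
- move=> x s; have [g gs] := ec_conjugates_infinite ecG (map val s) (valP x).
  by exists g; apply: contra gs => gs; exact: (map_f val gs).
- move=> Q; have [z z1 zQ] := ec_commuting ecG Q.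
  by exists (Sub z z1) => g gQ; apply: val_inj; exact: zQ.
Qed.
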